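(* Let $n\geq 11$ and let $G$ be a graph with vertex set $\mathbb{N}_n$. Then $G\in\mathcal{Q}_{-1}$ if and only if $G-n=Q_{n-1}$ and one of the following holds: $N_G(n)=\mathbb{N}_{n-3}\cup\{n-1\}$; or $N_G(n)=\{n-3\}$; or $N_G(n)=\{n-2,k\}$ where $k\in\mathbb{N}_{n-3}\setminus\{2\}$; or $N_G(n)=\{n-2,k,k+1\}$ where $k\in\{2,\dots,n-4\}$.
   Context: Graphs are finite, simple and undirected; $G-X=G[V(G)\setminus X]$ is the subgraph induced by $V(G)\setminus X$, $G-x=G-\{x\}$, and $N_G(x)$ is the set of vertices adjacent to $x$ in $G$. A subset $I\subseteq V(G)$ is an interval of $G$ if every vertex outside $I$ is adjacent to all or to none of the vertices of $I$. The sets $\emptyset$, $V(G)$ and $\{x\}$ ($x\in V(G)$) are the trivial intervals. $G$ is indecomposable if all its intervals are trivial. For an indecomposable graph $G=(V,E)$, the indecomposability graph $\mathbb{I}(G)$ has vertex set $V$, and its edges are the pairs $\{x,y\}$ of distinct vertices such that $G-\{x,y\}$ is indecomposable. A graph $H$ is $X$-covered, for $X\subseteq V(H)$, if every edge of $H$ meets $X$. Let $\mathbb{N}_n=\{1,\dots,n\}$. $P_n$ is the graph on $\mathbb{N}_n$ in which $i\ne j$ are adjacent iff $|i-j|=1$. For $n\geq 4$, $Q_n$ is the graph on $\mathbb{N}_n$ with edge set $E(P_{n-2})\cup\{\{n-1,i\}: i\in\mathbb{N}_n\setminus\{n-1,n-2\}\}$. $\mathcal{Q}_{-1}$ is the set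 of indecomposable graphs $G$ with vertex set $\mathbb{N}_n$ for some $n\geq 11$ such that $\mathbb{I}(G)$ is $\{1,n-1\}$-covered and $G-n=Q_{n-1}$. *)

(* Defs.v *)
From HB Require Import structures.
From mathcomp Require Import all_boot.
From mathcomp Require Import finmap.

Set Implicit Arguments.
Unset Strict Implicit.
Unset Printing Implicit Defensive.

Local Open Scope fset_scope.

(* A finite simple graph on vertices drawn from K: a finite vertex set and a
   finite set of 2-element subsets of it. Leibniz equality of graphs amounts to
   equality of both sets (sgraph_eq). *)
Section Graph.
Variable K : choiceType.
Implicit Types (V A I X : {fset K}) (E : {fset {fset K}}) (x y : K).

Definition edge_in V (e : {fset K}) : bool := (e `<=` V) && (#|` e| == 2).

Record sgraph := SGraph {
  vset : {fset K};
  eset : {fset {fset K}};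
  eset_in : all (edge_in vset) eset }.

Lemma sgraph_eq (G H : sgraph) : vset G = vset H -> eset G = eset H -> G = H.
Proof.
case: G H => [V E h] [V' E' h'] /= eV eE; move: h h'; rewrite eV eE => h h'.
by rewrite (bool_irrelevance h h').
Qed.

Lemma mkgraph_subproof V E : all (edge_in V) [fset e in E | edge_in V e].
Proof. by apply/allP => e; rewrite !inE => /andP[]. Qed.

(* Elements of E that are not 2-subsets of V are dropped. *)
Definition mkgraph V E : sgraph := SGraph (mkgraph_subproof V E).

Implicit Type G : sgraph.

Definition adj G x y : bool := (x != y) && ([fset x; y] \in eset G).

Definition nbhd G x : {fset K} := [fset y in vset G | adj G x y].

Definition induced G A : sgraph :=
  mkgraph (vset G `&` A) [fset e in eset G | e `<=` A].

Definition del G X : sgraph := induced G (vset G `\` X).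

Definition is_interval G I : bool :=
  (I `<=` vset G) &&
  all (fun x => all (adj G x) I || all (fun y => ~~ adj G x y) I)
      (vset G `\` I).

Definition trivial_interval G I : bool :=
  [|| I == fset0, I == vset G | has (fun x => I == [fset x]) (vset G)].

Definition indecomposable G : bool :=
  all (fun I => is_interval G I ==> trivial_interval G I)
      (fpowerset (vset G)).

(* The indecomposability graph of G; only meaningful for G indecomposable. *)
Definition indec_graph G : sgraph :=
  mkgraph (vset G)
    [fset e in fpowerset (vset G) | (#|` e| == 2) && indecomposable (del G e)].

Definition covered G X : Prop :=
  X `<=` vset G /\ forall e, e \in eset G -> exists2 x, x \in e & x \in X.

Lemma adj_sym G x y : adj G x y = adj G y x.
Proof. by rewrite /adj eq_sym fsetUC. Qed.

Lemma adj_vset G x y : adj G x y -> (x \in vset G) && (y \in vset G).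
Proof.
move=> /andP[_ /(allP (eset_in G)) /andP[/fsubsetP s _]].
by rewrite !s // !inE eqxx ?orbT.
Qed.

Lemma intervalP G I :
  reflect (I `<=` vset G /\
           forall x, x \in vset G -> x \notin I ->
             (forall y, y \in I -> adj G x y) \/
             (forall y, y \in I -> ~~ adj G x y))
          (is_interval G I).
Proof.
apply: (iffP andP) => -[sI h]; split=> //.
  move=> x xV xI; have xVI : x \in vset G `\` I by rewrite inE xI xV.
  by case/orP: (allP h x xVI) => /allP; [left|right].
apply/allP => x; rewrite inE => /andP[xI xV].
by apply/orP; case: (h x xV xI) => a; [left|right]; apply/allP.
Qed.

Lemma indecomposableP G :
  reflect (forall I, is_interval G I ->
             [\/ I = fset0, I = vset G
               | exists2 x, x \in vset G & I = [fset x]])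
          (indecomposable G).
Proof.
apply: (iffP allP) => h I.
  move=> iI; have /andP[sI _] := iI.
  have := h I; rewrite fpowersetE sI iI => /(_ isT) /or3P[/eqP|/eqP|/hasP[x xV /eqP]].
  - by constructor 1.
  - by constructor 2.
  - by constructor 3; exists x.
move=> _; apply/implyP => /h[->|->|[x xV ->]]; rewrite /trivial_interval ?eqxx ?orbT //.
by apply/or3P; constructor 3; apply/hasP; exists x.
Qed.

Lemma adj_mkgraph V E x y :
  adj (mkgraph V E) x y =
  [&& x != y, [fset x; y] \in E, x \in V & y \in V].
Proof.
rewrite /adj !inE /edge_in cardfs2 /= fsubUset !fsub1set.
by case: (x != y); rewrite //= andbT.
Qed.

Lemma adj_del G X x y :
  adj (del G X) x y = [&& x \notin X, y \notin X & adj G x y].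
Proof.
rewrite /adj !inE /edge_in cardfs2 /= !fsubUset !fsub1set !inE.
case: (eqVneq x y) => [|nxy] /=; first by rewrite !andbF.
case e: ([fset x; y] \in eset G); rewrite ?andbF //=.
have /andP[-> ->] : (x \in vset G) && (y \in vset G).
  by apply: adj_vset; rewrite /adj nxy.
by rewrite !andbT; case: (x \in X); case: (y \in X).
Qed.

Lemma adj_indec_graph G x y :
  adj (indec_graph G) x y =
  [&& x != y, x \in vset G, y \in vset G & indecomposable (del G [fset x; y])].
Proof.
rewrite /adj !inE /edge_in cardfs2 /= !fpowersetE !fsubUset !fsub1set.
by case: (x != y); case: (x \in _); case: (y \in _) => //=; rewrite ?andbT ?andbF.
Qed.

End Graph.

Definition NN (n : nat) : {fset nat} := [fset i in iota 1 n].

Definition Pgraph (n : nat) : sgraph nat :=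
  mkgraph (NN n)
    [fset [fset i; j] | i in NN n, j in NN n & (j == i.+1) || (i == j.+1)].

(* Q_n; only meaningful for n >= 4. *)
Definition Qgraph (n : nat) : sgraph nat :=
  mkgraph (NN n)
    (eset (Pgraph (n - 2)) `|`
     [fset [fset n - 1; i] | i in NN n `\` [fset n - 1; n - 2]]).

Lemma mem_NN n i : (i \in NN n) = (1 <= i <= n).
Proof. by rewrite inE mem_iota add1n ltnS. Qed.

Lemma adj_Pgraph n i j :
  adj (Pgraph n) i j =
  [&& i \in NN n, j \in NN n & (j == i.+1) || (i == j.+1)].
Proof.
rewrite adj_mkgraph; case: (eqVneq i j) => [->|nij] /=.
  by rewrite eqn_leq ltnn andbF /= !andbF.
apply/idP/idP.
  case/and3P=> /imfset2P[a _ [b /=]] + e -> -> /=.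
  move=> /andP[_ ab].
  have : i \in [fset a; b] by rewrite -e in_fset2 eqxx.
  have : j \in [fset a; b] by rewrite -e in_fset2 eqxx orbT.
  rewrite !in_fset2 => /orP[] /eqP ej /orP[] /eqP ei; move: nij;
    by rewrite ei ej ?eqxx // orbC.
case/and3P=> hi hj ij; rewrite hi hj !andbT.
by apply/imfset2P; exists i => //; exists j => //; apply/andP.
Qed.

Lemma adj_Qgraph n i j : 4 <= n ->
  adj (Qgraph n) i j =
  [|| adj (Pgraph (n - 2)) i j,
      [&& i == n - 1, j \in NN n, j != n - 1 & j != n - 2]
    | [&& j == n - 1, i \in NN n, i != n - 1 & i != n - 2]].
Proof.
move=> n4.
have n1 : n - 1 \in NN n by rewrite mem_NN subn_gt0 leq_subr (leq_trans _ n4).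
have subP k : k \in NN (n - 2) -> k \in NN n.
  by rewrite !mem_NN => /andP[-> /leq_trans -> //]; rewrite leq_subr.
rewrite adj_mkgraph in_fsetU; case: (eqVneq i j) => [<-|nij] /=.
  by rewrite /adj eqxx /=; case: (i == n - 1); rewrite /= ?andbF.
apply/idP/idP.
  case/and3P=> /orP[e _ _|/imfsetP[k /= + e]]; first by rewrite /adj nij e.
  rewrite in_fsetD in_fset2 negb_or => /andP[/andP[k1 k2] kV] iV jV.
  have : i \in [fset n - 1; k] by rewrite -e in_fset2 eqxx.
  have : j \in [fset n - 1; k] by rewrite -e in_fset2 eqxx orbT.
  rewrite !in_fset2; move: nij => + /orP[|] /eqP ej /orP[|] /eqP ei.
  - by rewrite ei ej eqxx.
  - by move=> _; rewrite ei ej kV k1 k2 eqxx !orbT.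
  - by move=> _; rewrite ei ej kV k1 k2 eqxx !orbT.
  - by rewrite ei ej eqxx.
case/or3P=> [a|/and4P[/eqP-> jV j1 j2]|/and4P[/eqP-> iV i1 i2]].
- have /andP[_ e] := a; have := a; rewrite adj_Pgraph => /and3P[iV jV _].
  by rewrite e !subP.
- rewrite n1 jV !andbT; apply/orP; right; apply/imfsetP; exists j => //=.
  by rewrite in_fsetD in_fset2 negb_or j1 j2.
- rewrite n1 iV !andbT; apply/orP; right; apply/imfsetP; exists i => /=.
    by rewrite in_fsetD in_fset2 negb_or i1 i2.
  by rewrite fsetUC.
Qed.

(* The class Q_{-1}; n is the number of vertices. *)
Definition Qm1 (G : sgraph nat) : Prop :=
  exists n : nat,
    [/\ 11 <= n, vset G = NN n, indecomposable G,
        covered (indec_graph G) [fset 1; n - 1]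
      & del G [fset n] = Qgraph (n - 1)].

(* Main.v *)
(* Put p = n-3, a = n-2, b = n-1, c = n: G - c is the path 1..p together with a
   vertex a adjacent to 1..p-1 and to the pendant vertex b.

   If N(c) is one of the listed sets, G is indecomposable since G - c is and c is
   neither complete nor isolated nor a twin of another vertex; and if x < y avoid
   1 and b, then one of {1..x-1, b}, {1..x-1, c}, V - b, V - c (intersected with
   the remaining vertices) is a nontrivial interval of G - {x, y}.

   Otherwise either c is complete, isolated or a twin of some vertex, so that G is
   decomposable, or G - {x, y} is indecomposable for one of the pairs {2, 3},
   {p-1, p}, {p, a}, and {k+1, k+2} with k the first neighbour of c on the path;
   the last pair is needed when c is adjacent to a and not to b. *)

Require Import Defs.
From mathcomp Require Import all_boot finmap zify.

Set Implicit Arguments.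
Unset Strict Implicit.
Unset Printing Implicit Defensive.

Local Open Scope fset_scope.

(* When e is symmetric, I is an interval iff it contains every vertex that is
   adjacent to one of its elements and not to another. *)
Definition closed_in (K : choiceType) (V I : pred K) (e : rel K) :=
  forall w u v, V w -> I u -> I v -> e w u -> ~~ e w v -> I w.

(** * Criteria for indecomposability and for decomposability *)

Section Intervals.
Context {K : choiceType}.
Implicit Types (G : sgraph K) (V I X : {fset K}).

(** Sets with at most one element are trivial intervals, so only a closed set with two distinct
    elements has to be shown to be everything. The indecomposability proofs below start from such a
    pair and keep adding vertices that are adjacent to one element of the set and not to another. *)
Lemma closed_indecomposable G :
  (forall I, I `<=` vset G -> closed_in (mem (vset G)) (mem I) (adj G) ->
     forall u v, u \in I -> v \in I -> u != v -> {subset vset G <= I}) ->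
  indecomposable G.
Proof.
move=> h; apply/indecomposableP => I /intervalP[sI iI].
have [->|[u uI]] := fset_0Vmem I; first by constructor 1.
have [/fset0Pn[v]|] := boolP (I `\ u != fset0).
  rewrite !inE => /andP[vu vI]; constructor 2; apply/eqP.
  rewrite eqEfsubset sI /=; apply/fsubsetP; apply: (h I sI _ v u) => //.
  move=> w x y /= wV xI yI wx; apply: contraNT => /(iI w wV)[] h'; first exact: h'.
  by move: (h' x xI); rewrite wx.
rewrite negbK => /eqP e0; constructor 3; exists u; first exact: (fsubsetP sI).
by rewrite -(fsetD1K uI) e0 fsetU0.
Qed.

Lemma proper_interval_decomposable G I u v w :
  I `<=` vset G -> u \in I -> v \in I -> u != v -> w \in vset G -> w \notin I ->
  (forall x, x \in vset G -> x \notin I ->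
     {in I, forall y, adj G x y} \/ {in I, forall y, ~~ adj G x y}) ->
  ~~ indecomposable G.
Proof.
move=> sI uI vI uv wV wI h; apply/indecomposableP => /(_ I).
case=> [|I0|IV|[x _ Ix]]; first by apply/intervalP.
- by rewrite I0 in uI.
- by rewrite IV wV in wI.
- by move: uI vI uv; rewrite Ix !inE => /eqP-> /eqP->; rewrite eqxx.
Qed.

Lemma twins_decomposable G u v w :
  u \in vset G -> v \in vset G -> w \in vset G -> u != v -> w != u -> w != v ->
  (forall x, x \in vset G -> x != u -> x != v -> adj G x u = adj G x v) ->
  ~~ indecomposable G.
Proof.
move=> uV vV wV uv wu wv h.
apply: (@proper_interval_decomposable G [fset u; v] u v w);
  rewrite ?fsubUset ?fsub1set ?uV ?inE ?eqxx ?orbT ?negb_or ?wu //.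
move=> x xV; rewrite !inE negb_or => /andP[xu xv].
by have := h x xV xu xv; case E: (adj G x u) => E';
  [left|right] => y; rewrite !inE => /orP[]/eqP->; rewrite -?E' ?E.
Qed.

(** The boolean [b] covers a complete and an isolated z at once: in both cases V - z is an
    interval. *)
Lemma singleton_complement_decomposable G z u v (b : bool) :
  z \in vset G -> u \in vset G -> v \in vset G -> u != v -> u != z -> v != z ->
  (forall x, x \in vset G -> x != z -> adj G z x = b) -> ~~ indecomposable G.
Proof.
move=> zV uV vV uv uz vz h.
apply: (@proper_interval_decomposable G (vset G `\ z) u v z);
  rewrite ?in_fsetD1 ?eqxx ?uz ?vz ?uV ?vV //; first exact: fsubD1set.
move=> x xV; rewrite in_fsetD1 xV andbT negbK => /eqP->.
by case: b h => h; [left|right] => y; rewrite in_fsetD1 => /andP[yz yV];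
  rewrite (h y yV yz).
Qed.

Lemma mem_del G X x : (x \in vset (del G X)) = (x \in vset G) && (x \notin X).
Proof. by rewrite !inE; case: (x \in vset G); rewrite ?andbT ?andbF. Qed.

(** Phrased with the adjacency of [G] instead of that of [del G X], so that adjacency lemmas about
    [G] apply directly. *)
Lemma closed_indecomposable_del G X :
  (forall I, {subset I <= vset G} ->
     closed_in [pred x | (x \in vset G) && (x \notin X)] (mem I) (adj G) ->
     (forall x, x \in I -> x \notin X) ->
     forall u v, u \in I -> v \in I -> u != v ->
     forall w, w \in vset G -> w \notin X -> w \in I) ->
  indecomposable (del G X).
Proof.
move=> h; apply: closed_indecomposable => I /fsubsetP sI cI u v uI vI uv w.
have I_X x : x \in I -> x \notin X by move/sI; rewrite mem_del => /andP[].
rewrite mem_del => /andP[wV wX]; apply: (h I _ _ I_X u v) => //.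
  by move=> x /sI; rewrite mem_del => /andP[].
move=> x y z /= /andP[xV xX] yI zI; have := cI x y z.
by rewrite /= mem_del !adj_del xV xX !I_X //=; apply.
Qed.

End Intervals.

Local Open Scope nat_scope.

(** * Closed sets along a path *)

(** Meant for a closed I with an element that is nonadjacent to the whole path lo, ..., hi: then
    every path neighbour of an element of I belongs to I. *)
Lemma path_spread (lo hi : nat) (I : pred nat) (i j : nat) :
  (forall w, lo <= w < hi -> I w = I w.+1) ->
  lo <= i <= hi -> lo <= j <= hi -> I i -> I j.
Proof.
move=> h; have E d k : lo <= k -> k + d <= hi -> I k = I (k + d).
  elim: d => [|d IH] lk kh; first by rewrite addn0.
  by rewrite addnS -h ?[I k]IH //; lia.
move=> hi1 hj; have [ij|ji] := leqP i j.
  by rewrite -(subnKC ij) -E //; lia.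
by rewrite -{1}(subnKC (ltnW ji)) -E //; lia.
Qed.

(** Two consecutive elements of I spread in both directions, since the next vertex is adjacent to
    the nearer one and not to the other. The exception is a path with three vertices, whose middle
    vertex does not separate the two ends. *)
Lemma path_closed (lo hi : nat) (I : pred nat) (i j : nat) :
  (forall w u v, lo <= w <= hi -> lo <= u <= hi -> lo <= v <= hi -> I u -> I v ->
     (u == w.+1) || (w == u.+1) -> ~~ ((v == w.+1) || (w == v.+1)) -> I w) ->
  lo <= i -> i < j -> j <= hi -> I i -> I j ->
  (forall w, lo <= w <= hi -> I w) \/ [/\ i = lo, j = hi & hi = lo.+2].
Proof.
move=> cl li ij jh Ii Ij.
have consec k : lo <= k < hi -> I k -> I k.+1 -> forall w, lo <= w <= hi -> I w.
  move=> hk Ik Ik1.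
  have up d : k + d < hi -> I (k + d) && I (k + d).+1.
    elim: d => [|d IH] hd; first by rewrite addn0 Ik.
    have /andP[I1 I2] : I (k + d) && I (k + d).+1 by apply: IH; lia.
    by rewrite addnS I2 /=; apply: (cl _ (k + d).+1 (k + d)) => //; lia.
  have down d : lo + d <= k -> I (k - d) && I (k - d).+1.
    elim: d => [|d IH] hd; first by rewrite subn0 Ik.
    have /andP[I1 I2] : I (k - d) && I (k - d).+1 by apply: IH; lia.
    have -> : (k - d.+1).+1 = k - d by lia.
    by rewrite I1 andbT; apply: (cl _ (k - d) (k - d).+1) => //; lia.
  move=> w hw; have [wk|kw] := leqP w k.
    have /andP[+ _] : I (k - (k - w)) && I (k - (k - w)).+1 by apply: down; lia.
    by rewrite subKn.
  have /andP[_] : I (k + (w - k.+1)) && I (k + (w - k.+1)).+1 by apply: up; lia.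
  by rewrite -addSn subnKC.
have [Ii1|nIi1] := boolP (I i.+1); first by left; apply: (consec i) => //; lia.
(* The vertex i+1 is adjacent to i, so it can stay outside I only by being adjacent to j as well. *)
have ji2 : j = i.+2.
  apply/eqP; apply: contraNT nIi1 => nj.
  have [<- //|nj1] := eqVneq j i.+1.
  by apply: (cl _ i j) => //; lia.
(* If the path continues beyond i or j, the next vertex is adjacent to only one of them and joins I,
   which gives two consecutive elements. *)
have [il|il] := eqVneq i lo; last first.
  left; apply: (consec i.-1); rewrite ?prednK //; try lia.
  by apply: (cl _ i j) => //; lia.
have [jl|jl] := eqVneq j hi; last first.
  left; apply: (consec j) => //; try lia.
  by apply: (cl _ j i) => //; lia.
by right; split=> //; rewrite -jl ji2 il.
Qed.

Lemma const_or_not (m : nat) (s : pred nat) :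
  [\/ forall i, 1 <= i <= m -> s i, forall i, 1 <= i <= m -> ~~ s i
    | exists u v, [/\ 1 <= u <= m, 1 <= v <= m, s u & ~~ s v]].
Proof.
have memm i : (i \in iota 1 m) = (1 <= i <= m) by rewrite mem_iota; lia.
have [/allP h|/allPn[v hv nsv]] := boolP (all s (iota 1 m)).
  by constructor 1 => i hi; apply: h; rewrite memm.
have [/hasP[u hu su]|/hasPn h] := boolP (has s (iota 1 m)).
  by constructor 3; exists u, v; rewrite -!memm.
by constructor 2 => i hi; apply: h; rewrite memm.
Qed.

Lemma first_last (m : nat) (s : pred nat) :
  (exists2 i, 1 <= i <= m & s i) ->
  exists k l, [/\ 1 <= k <= l, l <= m, s k, s l
    & forall i, 1 <= i <= m -> s i -> k <= i <= l].
Proof.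
move=> [i0 hi0 si0].
have ex : exists i, (1 <= i <= m) && s i by exists i0; rewrite hi0.
have ub i : (1 <= i <= m) && s i -> i <= m by lia.
case: (ex_minnP ex) => k /andP[hk sk] kmin.
case: (ex_maxnP ex ub) => l /andP[hl sl] lmax.
exists k, l; split=> //; first by rewrite lmax ?hk ?sk //; case/andP: hk => ->.
  by case/andP: hl.
by move=> i hi si; rewrite kmin ?lmax ?hi.
Qed.

(** * The graph Q and its extensions by one vertex *)

(** This is adjacency in Q_{p+2}, meaningful only for indices from 1 to p+2. *)
Definition Qadj (p i j : nat) : bool :=
  [|| [&& i <= p, j <= p & (j == i.+1) || (i == j.+1)],
      (i == p.+1) && ((j < p) || (j == p.+2))
    | (j == p.+1) && ((i < p) || (i == p.+2))].

(* The vertices p+1, p+2 and p+3 are the vertices n-2, n-1 and n of the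
   statement, and 1, ..., p is the path. *)
Definition Qextension (p : nat) (G : sgraph nat) : Prop :=
  vset G = NN p.+3 /\
  forall i j, 1 <= i <= p.+2 -> 1 <= j <= p.+2 -> adj G i j = Qadj p i j.

Lemma del_Qgraph_Qextension (p : nat) (G : sgraph nat) :
  1 < p -> vset G = NN p.+3 -> del G [fset p.+3] = Qgraph p.+2 -> Qextension p G.
Proof.
move=> p1 VG dG; split=> // i j hi hj.
have <- : adj (del G [fset p.+3]) i j = adj G i j.
  rewrite adj_del !inE.
  have [-> ->] : i != p.+3 /\ j != p.+3 by split; lia.
  by [].
rewrite dG adj_Qgraph; last by lia.
by rewrite adj_Pgraph !mem_NN /Qadj; lia.
Qed.

(** Each pair of elements of I leads to the pair {a, e}, and that pair to everything. The graph is
    abstract because two copies of Q occur: the path 1, ..., p with pendant vertex b, and, after 2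
    and 3 are deleted, the path 4, ..., p with pendant vertex 1 or b. *)
Lemma Q_closed (lo p a e : nat) (I : pred nat) (E : rel nat) :
  (forall w u v, [|| w == a, w == e | lo <= w <= p] -> I u -> I v ->
     E w u -> ~~ E w v -> I w) ->
  (forall x y, lo <= x <= p -> lo <= y <= p ->
     E x y = (y == x.+1) || (x == y.+1)) ->
  (forall x, lo <= x <= p -> E a x = (x < p)) ->
  (forall x, lo <= x <= p -> E x a = (x < p)) ->
  (forall x, lo <= x <= p -> E e x = false) ->
  (forall x, lo <= x <= p -> E x e = false) ->
  E a e -> E e a -> lo + 3 <= p ->
  forall u v, [|| u == a, u == e | lo <= u <= p] ->
    [|| v == a, v == e | lo <= v <= p] -> u != v -> I u -> I v ->
  forall w, [|| w == a, w == e | lo <= w <= p] -> I w.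
Proof.
move=> cl Epath Eax Exa Eex Exe Eae Eea lop.
have cla := cl a; rewrite eqxx /= in cla.
have cle := cl e; rewrite eqxx /= orbT in cle.
have clx w u v : lo <= w <= p -> I u -> I v -> E w u -> ~~ E w v -> I w.
  by move=> hw; apply: cl; rewrite hw !orbT.
have pP : lo <= p <= p by lia.
have p1P : lo <= p.-1 <= p by lia.
have p1p : p == p.-1.+1 by lia.
have path_a i : lo <= i < p -> I i -> I p -> I a.
  move=> hi Ii Ip; have iP : lo <= i <= p by lia.
  by apply: (cla i p) => //; rewrite ?Eax ?ltnn //; case/andP: hi.
(* Every path vertex below p separates a from e; p is adjacent to neither, and follows from p-1 and
   e. *)
have ae : I a -> I e -> forall w, [|| w == a, w == e | lo <= w <= p] -> I w.
  move=> Ia Ie.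
  have low x : lo <= x < p -> I x.
    move=> hx; have xP : lo <= x <= p by lia.
    by apply: (clx _ a e); rewrite ?Exa ?Exe //; case/andP: hx.
  have Ip : I p.
    have Ip1 : I p.-1 by apply: low; lia.
    by apply: (clx _ p.-1 e); rewrite ?Exe // Epath // p1p orbT.
  move=> w /or3P[/eqP->|/eqP->|] // hw.
  by have [->|wp] := eqVneq w p => //; apply: low; lia.
have ax x : lo <= x <= p -> I a -> I x ->
    forall w, [|| w == a, w == e | lo <= w <= p] -> I w.
  by move=> hx Ia Ix; apply: (ae Ia); apply: (cle a x) => //; rewrite Eex.
have full : (forall x, lo <= x <= p -> I x) ->
    forall w, [|| w == a, w == e | lo <= w <= p] -> I w.
  move=> h; have Ip := h p pP; have Ilo : I lo by apply: h; lia.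
  by apply: (ax p) => //; apply: (path_a lo) => //; lia.
have ex x : lo <= x <= p -> I e -> I x ->
    forall w, [|| w == a, w == e | lo <= w <= p] -> I w.
  move=> hx Ie Ix; apply: full => y hy.
  apply: (@path_spread lo p I x y) => // w hw.
  have wP : lo <= w <= p by lia.
  have w1P : lo <= w.+1 <= p by lia.
  apply/idP/idP => h; [apply: (clx _ w e)|apply: (clx _ w.+1 e)];
    by rewrite ?Exe ?Epath ?eqxx ?orbT.
have xx x y : lo <= x -> x < y -> y <= p -> I x -> I y ->
    forall w, [|| w == a, w == e | lo <= w <= p] -> I w.
  move=> hx xy yp Ix Iy.
  (* The path has at least four vertices, which excludes the exceptional case. *)
  case: (@path_closed lo p I x y) => // [|[_ _ pE]]; last by clear - lop pE; lia.
  by move=> w u v hw hu hv Iu Iv; rewrite -!Epath //; apply: clx.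
move=> u v /or3P[/eqP->|/eqP->|hu] /or3P[/eqP->|/eqP->|hv] uv Iu Iv;
  try by rewrite eqxx in uv.
- exact: ae.
- exact: (ax v).
- exact: ae.
- exact: (ex v).
- exact: (ax u).
- exact: (ex u).
- case/andP: hu hv => lu up /andP[lv vp].
  by case: (ltngtP u v) uv => // h _; [apply: (xx u v)|apply: (xx v u)].
Qed.

Section Adjacency.
Context (p : nat) (G : sgraph nat) (QG : Qextension p G).

Lemma adj_path i j : 1 <= i <= p -> 1 <= j <= p ->
  adj G i j = (j == i.+1) || (i == j.+1).
Proof. by move=> hi hj; rewrite (proj2 QG) /Qadj; lia. Qed.

Lemma adj_ap i : 1 <= i <= p -> adj G p.+1 i = (i < p).
Proof. by move=> hi; rewrite (proj2 QG) /Qadj; lia. Qed.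

Lemma adj_pa i : 1 <= i <= p -> adj G i p.+1 = (i < p).
Proof. by move=> hi; rewrite adj_sym adj_ap. Qed.

Lemma adj_bp i : 1 <= i <= p -> adj G p.+2 i = false.
Proof. by move=> hi; rewrite (proj2 QG) /Qadj; lia. Qed.

Lemma adj_pb i : 1 <= i <= p -> adj G i p.+2 = false.
Proof. by move=> hi; rewrite adj_sym adj_bp. Qed.

Lemma adj_ab : adj G p.+1 p.+2.
Proof. by rewrite (proj2 QG) /Qadj; lia. Qed.

Lemma adj_ba : adj G p.+2 p.+1.
Proof. by rewrite adj_sym adj_ab. Qed.

(** * Indecomposability of G and of some G - {x, y} *)

(** A pair inside G - c yields all of G - c by [Q_closed], and then c, which has a neighbour and a
    non-neighbour there. A pair {x, c} gains a vertex separating x from c, which reduces it to the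
    first case. *)
Lemma Qextension_indecomposable :
  4 <= p ->
  (exists u v, [/\ 1 <= u <= p.+2, 1 <= v <= p.+2, adj G p.+3 u & ~~ adj G p.+3 v]) ->
  (forall v, 1 <= v <= p.+2 ->
     exists w, [/\ 1 <= w <= p.+2, w != v & adj G w v != adj G w p.+3]) ->
  indecomposable G.
Proof.
move=> p4 [t [t' [ht ht' ct ct']]] ntwin; have [VG _] := QG.
apply: closed_indecomposable => I /fsubsetP sI cI u v uI vI uv w0.
have cl w x y : 1 <= w <= p.+3 -> x \in I -> y \in I -> adj G w x ->
    ~~ adj G w y -> w \in I.
  by move=> hw; apply: cI; rewrite /= VG mem_NN.
have qq x y : 1 <= x <= p.+2 -> 1 <= y <= p.+2 -> x != y -> x \in I -> y \in I ->
    forall w, 1 <= w <= p.+2 -> w \in I.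
  move=> hx hy xy xI yI w hw.
  apply: (@Q_closed 1 p p.+1 p.+2 (mem I) (adj G) _ _ _ _ _ _ _ _ _ x y) => //.
  - by move=> w' x' y' hw'; apply: cl; lia.
  - exact: adj_path.
  - exact: adj_ap.
  - exact: adj_pa.
  - exact: adj_bp.
  - exact: adj_pb.
  - exact: adj_ab.
  - exact: adj_ba.
  - by lia.
  - by lia.
  - by lia.
have full x y : 1 <= x <= p.+2 -> 1 <= y <= p.+2 -> x != y -> x \in I -> y \in I ->
    1 <= w0 <= p.+3 -> w0 \in I.
  move=> hx hy xy xI yI hw0; have all := qq x y hx hy xy xI yI.
  have [->|nw0] := eqVneq w0 p.+3; last by apply: all; lia.
  by apply: (cl _ t t') => //; [lia|apply: all|apply: all].
have cx x : 1 <= x <= p.+2 -> x \in I -> p.+3 \in I -> 1 <= w0 <= p.+3 -> w0 \in I.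
  move=> hx xI cI'; have [w [hw wx awx]] := ntwin x hx.
  apply: (full w x) => //; have hw3 : 1 <= w <= p.+3 by lia.
  case E1: (adj G w x) awx; case E2: (adj G w p.+3) => // _.
    by apply: (cl _ x p.+3); rewrite ?E2.
  by apply: (cl _ p.+3 x); rewrite ?E1.
have rng x : x \in I -> (1 <= x <= p.+2) || (x == p.+3).
  by move/sI; rewrite VG mem_NN; lia.
rewrite VG mem_NN; case/orP: (rng u uI) => [hu|/eqP uc].
  case/orP: (rng v vI) => [hv|/eqP vc]; first exact: (full u v).
  by apply: (cx u); rewrite -?vc.
case/orP: (rng v vI) => [hv|/eqP vc]; last by rewrite uc vc eqxx in uv.
by apply: (cx v); rewrite -?uc.
Qed.

(** Without 2 and 3, the vertices 1 and b are both pendant at a as long as c is ignored, so c must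
    separate them. If c is adjacent to a, a neighbour t on 4, ..., p is required as well: otherwise
    c would be a twin of its neighbour among 1 and b. *)
Lemma del_2_3_indecomposable :
  7 <= p -> adj G p.+3 1 != adj G p.+3 p.+2 ->
  (adj G p.+3 p.+1 -> exists2 t, 4 <= t <= p & adj G p.+3 t) ->
  indecomposable (del G [fset 2; 3]).
Proof.
move=> p7 c1b ca; have [VG _] := QG.
have wd i : 4 <= i <= p -> 1 <= i <= p by lia.
have nbr x : 4 <= x <= p -> exists2 y, 4 <= y <= p & (y == x.+1) || (x == y.+1).
  by move=> hx; have [xp|xp] := ltnP x p; [exists x.+1|exists x.-1]; lia.
(* Among 1 and b, d is the neighbour of c and e the other one. The two cases are symmetric and are
   treated together from here on. *)
have [d [e [de cd ce]]] : exists d e, [/\ (d == 1) && (e == p.+2) || (d == p.+2) && (e == 1),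
    adj G p.+3 d & ~~ adj G p.+3 e].
  case E1: (adj G p.+3 1) c1b; case E2: (adj G p.+3 p.+2) => // _.
    by exists 1, p.+2; rewrite E1 E2 !eqxx.
  by exists p.+2, 1; rewrite E1 E2 !eqxx orbT.
have d1b : (d == 1) || (d == p.+2) by lia.
have e1b : (e == 1) || (e == p.+2) by lia.
have two : 1 <= 1 <= p by lia.
have twin_a x : (x == 1) || (x == p.+2) -> adj G p.+1 x /\ adj G x p.+1.
  case/orP=> /eqP->; last by rewrite adj_ab adj_ba.
  by rewrite adj_ap // adj_pa //; split; lia.
have twin_p x y : (x == 1) || (x == p.+2) -> 4 <= y <= p ->
    adj G x y = false /\ adj G y x = false.
  move=> hx hy; have hy' : 1 <= y <= p by lia.
  case/orP: hx => /eqP->; last by rewrite adj_bp // adj_pb.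
  by rewrite !adj_path //; split; lia.
have nde : ~~ adj G d e.
  case/orP: de => /andP[/eqP-> /eqP->]; first by rewrite adj_pb.
  by rewrite adj_bp.
have [ad da] := twin_a d d1b; have [ae ea] := twin_a e e1b.
have pd y (hy : 4 <= y <= p) := twin_p d y d1b hy.
have pe y (hy : 4 <= y <= p) := twin_p e y e1b hy.
clear two twin_a twin_p c1b.
apply: closed_indecomposable_del => I sI cI IX u v uI vI uv w0 w0V w0X.
(* The copy of Q to which [Q_closed] applies; only d and c lie outside it. *)
pose inQ x := [|| x == p.+1, x == e | 4 <= x <= p].
have split5 x : x \in vset G -> x \notin [fset 2; 3] ->
    [|| inQ x, x == d | x == p.+3].
  by rewrite VG mem_NN !inE /inQ; clear - de p7; lia.
have inQV x : inQ x || (x == d) || (x == p.+3) -> (x \in vset G) && (x \notin [fset 2; 3]).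
  by rewrite VG mem_NN !inE /inQ; clear - de p7; lia.
have cl w x y : inQ w || (w == d) || (w == p.+3) -> x \in I -> y \in I -> adj G w x ->
    ~~ adj G w y -> w \in I.
  by move=> hw; apply: cI; apply: inQV.
have cld w x : w \in I -> x \in I -> adj G d w -> ~~ adj G d x -> d \in I.
  by apply: cl; rewrite eqxx orbT.
have clc w x : w \in I -> x \in I -> adj G p.+3 w -> ~~ adj G p.+3 x -> p.+3 \in I.
  by apply: cl; rewrite eqxx orbT.
have clQ w x y : inQ w -> x \in I -> y \in I -> adj G w x ->
    ~~ adj G w y -> w \in I.
  by move=> hw; apply: cl; rewrite hw.
have Qa : inQ p.+1 by rewrite /inQ eqxx.
have Qe : inQ e by rewrite /inQ eqxx orbT.
have Qx x : 4 <= x <= p -> inQ x by rewrite /inQ => ->; rewrite !orbT.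
have ane : p.+1 != e by clear - e1b p7; lia.
have ca' : ~~ adj G p.+3 p.+1 -> ~~ adj G p.+1 p.+3 by rewrite adj_sym.
have qq x y : inQ x -> inQ y -> x != y -> x \in I -> y \in I -> w0 \in I.
  move=> hx hy xy xI yI.
  have all w : inQ w -> w \in I.
    apply: (@Q_closed 4 p p.+1 e (mem I) (adj G) _ _ _ _ _ _ _ _ _ x y) => //.
    - by move=> i j /wd hi /wd; apply: adj_path.
    - by move=> i /wd; apply: adj_ap.
    - by move=> i /wd; apply: adj_pa.
    - by move=> i /pe[].
    - by move=> i /pe[].
  have dI : d \in I by apply: (cld p.+1 e) => //; apply: all.
  have cI' : p.+3 \in I by apply: (clc d e) => //; apply: all.
  by case/or3P: (split5 w0 w0V w0X) => [/all|/eqP->|/eqP->].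
have dx x : 4 <= x <= p -> d \in I -> x \in I -> w0 \in I.
  move=> hx dI xI.
  have [y hy xy] := nbr x hx.
  have [_ yd] := pd y hy.
  apply: (qq x y); rewrite ?Qx //; first by clear - xy; lia.
  by apply: (clQ _ x d); rewrite ?Qx ?yd // adj_path ?wd // orbC.
have daQ : d \in I -> p.+1 \in I -> w0 \in I.
  move=> dI aI; apply: (qq p.+1 e) => //; apply: (clQ _ p.+1 d) => //.
  by rewrite adj_sym.
(* The vertex a is adjacent to d, so it separates d from c unless c is adjacent to a; in that case t
   does. *)
have dc : d \in I -> p.+3 \in I -> w0 \in I.
  move=> dI cI'; have [/ca[t ht ct]|/ca' nac] := boolP (adj G p.+3 p.+1).
    apply: (dx t) => //; have [_ td] := pd t ht.
    by apply: (clQ _ p.+3 d); rewrite ?Qx ?td // adj_sym.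
  by apply: daQ => //; apply: (clQ _ d p.+3).
have cQ x : inQ x -> x \in I -> p.+3 \in I -> w0 \in I.
  case/or3P=> [/eqP->|/eqP->|hx] xI cI'.
  - by apply: (qq p.+1 e) => //; apply: (clQ _ p.+1 p.+3) => //; rewrite adj_sym.
  - by apply: dc => //; apply: (cld p.+3 e) => //; rewrite adj_sym.
  - have [dx0 _] := pd x hx.
    by apply: (dx x) => //; apply: (cld p.+3 x); rewrite ?dx0 // adj_sym.
have dQ x : inQ x -> x \in I -> d \in I -> w0 \in I.
  case/or3P=> [/eqP->|/eqP->|hx] xI dI.
  - exact: daQ.
  - by apply: dc => //; apply: (clc d e).
  - exact: (dx x).
have spl x : x \in I -> [|| inQ x, x == d | x == p.+3].
  by move=> xI; apply: split5; [apply: sI|apply: IX].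
case/or3P: (spl u uI) => [hu|/eqP ud|/eqP uc];
  case/or3P: (spl v vI) => [hv|/eqP vd|/eqP vc]; subst.
- exact: (qq u v).
- exact: (dQ u).
- exact: (cQ u).
- exact: (dQ v).
- by rewrite eqxx in uv.
- exact: dc.
- exact: (cQ v).
- exact: dc.
- by rewrite eqxx in uv.
Qed.

(** Once p-1 and p are gone, a is adjacent to everything except c, and b only to a. Every pair of
    elements of I leads to the whole path 1, ..., p-2, on which c is not constant, and so to
    everything. *)
Lemma del_path_end_indecomposable :
  6 <= p -> ~~ adj G p.+3 p.+1 -> ~~ adj G p.+3 p.+2 ->
  (exists u v, [/\ 1 <= u <= p - 2, 1 <= v <= p - 2, adj G p.+3 u & ~~ adj G p.+3 v]) ->
  indecomposable (del G [fset p - 1; p]).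
Proof.
move=> p6 ca cb [t [t' [ht ht' ct ct']]]; have [VG _] := QG.
have ac : ~~ adj G p.+1 p.+3 by rewrite adj_sym.
have bc : ~~ adj G p.+2 p.+3 by rewrite adj_sym.
have wd i : 1 <= i <= p - 2 -> 1 <= i <= p by lia.
have pax i : 1 <= i <= p - 2 -> adj G i p.+1.
  by move=> hi; rewrite adj_pa; lia.
have apx i : 1 <= i <= p - 2 -> adj G p.+1 i by move=> hi; rewrite adj_sym pax.
have one : 1 <= 1 <= p - 2 by lia.
(* Excludes the exceptional case of [path_closed]. *)
have short : p - 2 = 3 -> False by lia.
apply: closed_indecomposable_del => I sI cI IX u v uI vI uv w0 w0V w0X.
have spl x : x \in vset G -> x \notin [fset p - 1; p] ->
    [|| 1 <= x <= p - 2, x == p.+1, x == p.+2 | x == p.+3].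
  by rewrite VG mem_NN !inE; clear; lia.
have splV x : [|| 1 <= x <= p - 2, x == p.+1, x == p.+2 | x == p.+3] ->
    (x \in vset G) && (x \notin [fset p - 1; p]).
  by rewrite VG mem_NN !inE; clear - p6; lia.
have clx w x y : 1 <= w <= p - 2 -> x \in I -> y \in I -> adj G w x ->
    ~~ adj G w y -> w \in I.
  by move=> hw; apply: cI; apply: splV; rewrite hw.
have cla x y : x \in I -> y \in I -> adj G p.+1 x -> ~~ adj G p.+1 y -> p.+1 \in I.
  by apply: cI; apply: splV; rewrite eqxx !orbT.
have clb x y : x \in I -> y \in I -> adj G p.+2 x -> ~~ adj G p.+2 y -> p.+2 \in I.
  by apply: cI; apply: splV; rewrite eqxx !orbT.
have clc x y : x \in I -> y \in I -> adj G p.+3 x -> ~~ adj G p.+3 y -> p.+3 \in I.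
  by apply: cI; apply: splV; rewrite eqxx !orbT.
have full : (forall x, 1 <= x <= p - 2 -> x \in I) -> w0 \in I.
  move=> all; have cI' : p.+3 \in I.
    by apply: (clc t t') => //; apply: all.
  have I1 : 1 \in I by apply: all.
  have aI : p.+1 \in I by apply: (cla 1 p.+3) => //; apply: apx.
  have bI : p.+2 \in I.
    by apply: (clb p.+1 p.+3) => //; rewrite adj_ba.
  by case/or4P: (spl w0 w0V w0X) => [/all|/eqP->|/eqP->|/eqP->].
have ab : p.+1 \in I -> p.+2 \in I -> w0 \in I.
  move=> aI bI; apply: full => x hx.
  by apply: (clx _ p.+1 p.+2) => //; [exact: pax|rewrite adj_pb // wd].
have ax x : 1 <= x <= p - 2 -> p.+1 \in I -> x \in I -> w0 \in I.
  move=> hx aI xI; apply: ab => //.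
  by apply: (clb p.+1 x) => //; [exact: adj_ba|rewrite adj_bp // wd].
have bx x : 1 <= x <= p - 2 -> p.+2 \in I -> x \in I -> w0 \in I.
  move=> hx bI xI; apply: full => y hy.
  apply: (@path_spread 1 (p - 2) (mem I) x y) => // w hw /=.
  have hw1 : 1 <= w <= p - 2 by clear - hw; lia.
  have hw2 : 1 <= w.+1 <= p - 2 by clear - hw; lia.
  apply/idP/idP => h; [apply: (clx _ w p.+2)|apply: (clx _ w.+1 p.+2)];
    by rewrite ?adj_pb ?adj_path ?wd // eqxx ?orbT.
have xx x y : 1 <= x -> x < y -> y <= p - 2 -> x \in I -> y \in I -> w0 \in I.
  move=> hx xy yp xI yI; apply: full.
  case: (@path_closed 1 (p - 2) (mem I) x y) => // [|[_ _ /short]] //.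
  move=> w' u' v' hw hu hv Iu Iv; rewrite -!adj_path ?wd //; exact: clx.
have cx x : 1 <= x <= p - 2 -> p.+3 \in I -> x \in I -> w0 \in I.
  by move=> hx cI' xI; apply: (ax x) => //; apply: (cla x p.+3) => //; exact: apx.
have ca' : p.+3 \in I -> p.+1 \in I -> w0 \in I.
  by move=> cI' aI; apply: ab => //; apply: (clb p.+1 p.+3); rewrite ?adj_ba.
have cb' : p.+3 \in I -> p.+2 \in I -> w0 \in I.
  by move=> cI' bI; apply: ab => //; apply: (cla p.+2 p.+3) => //; exact: adj_ab.
have splI x : x \in I -> [|| 1 <= x <= p - 2, x == p.+1, x == p.+2 | x == p.+3].
  by move=> xI; apply: spl; [apply: sI|apply: IX].
case/or4P: (splI u uI) => [hu|/eqP uE|/eqP uE|/eqP uE];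
  case/or4P: (splI v vI) => [hv|/eqP vE|/eqP vE|/eqP vE];
  subst; try (by rewrite eqxx in uv);
  try solve [exact: ab | exact: ca' | exact: cb' | apply: ax; eassumption | apply: bx; eassumption | apply: cx; eassumption].
case/andP: hu hv => u1 u2 /andP[v1 v2].
by case: (ltngtP u v) uv => // h _; [apply: (xx u v)|apply: (xx v u)].
Qed.

(** What remains is the path 1, ..., p-1, the vertex c, and b pendant at c. The pair {b, c} gives a
    path neighbour of c, a pair {c, x} gives b, and b together with a path vertex gives the whole
    path, because b has no neighbour on it. *)
Lemma del_path_end_a_indecomposable :
  5 <= p -> adj G p.+3 p.+2 ->
  (exists u v, [/\ 1 <= u <= p - 1, 1 <= v <= p - 1, adj G p.+3 u & ~~ adj G p.+3 v]) ->
  indecomposable (del G [fset p; p.+1]).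
Proof.
move=> p5 cb [t [t' [ht ht' ct ct']]]; have [VG _] := QG.
have bc : adj G p.+2 p.+3 by rewrite adj_sym.
have tc : adj G t p.+3 by rewrite adj_sym.
have wd i : 1 <= i <= p - 1 -> 1 <= i <= p by lia.
have one : 1 <= 1 <= p - 1 by lia.
have short : p - 1 = 3 -> False by lia.
apply: closed_indecomposable_del => I sI cI IX u v uI vI uv w0 w0V w0X.
have spl x : x \in vset G -> x \notin [fset p; p.+1] ->
    [|| 1 <= x <= p - 1, x == p.+2 | x == p.+3].
  by rewrite VG mem_NN !inE; clear; lia.
have splV x : [|| 1 <= x <= p - 1, x == p.+2 | x == p.+3] ->
    (x \in vset G) && (x \notin [fset p; p.+1]).
  by rewrite VG mem_NN !inE; clear - p5; lia.
have clx w x y : 1 <= w <= p - 1 -> x \in I -> y \in I -> adj G w x ->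
    ~~ adj G w y -> w \in I.
  by move=> hw; apply: cI; apply: splV; rewrite hw.
have clb x y : x \in I -> y \in I -> adj G p.+2 x -> ~~ adj G p.+2 y -> p.+2 \in I.
  by apply: cI; apply: splV; rewrite eqxx !orbT.
have clc x y : x \in I -> y \in I -> adj G p.+3 x -> ~~ adj G p.+3 y -> p.+3 \in I.
  by apply: cI; apply: splV; rewrite eqxx !orbT.
have full : (forall x, 1 <= x <= p - 1 -> x \in I) -> w0 \in I.
  move=> all; have cI' : p.+3 \in I.
    by apply: (clc t t') => //; apply: all.
  have bI : p.+2 \in I.
    have I1 : 1 \in I by apply: all.
    by apply: (clb p.+3 1) => //; rewrite adj_bp // wd.
  by case/or3P: (spl w0 w0V w0X) => [/all|/eqP->|/eqP->].
have bx x : 1 <= x <= p - 1 -> p.+2 \in I -> x \in I -> w0 \in I.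
  move=> hx bI xI; apply: full => y hy.
  apply: (@path_spread 1 (p - 1) (mem I) x y) => // w hw /=.
  have hw1 : 1 <= w <= p - 1 by clear - hw; lia.
  have hw2 : 1 <= w.+1 <= p - 1 by clear - hw; lia.
  apply/idP/idP => h; [apply: (clx _ w p.+2)|apply: (clx _ w.+1 p.+2)];
    by rewrite ?adj_pb ?adj_path ?wd // eqxx ?orbT.
have xx x y : 1 <= x -> x < y -> y <= p - 1 -> x \in I -> y \in I -> w0 \in I.
  move=> hx xy yp xI yI; apply: full.
  case: (@path_closed 1 (p - 1) (mem I) x y) => // [|[_ _ /short]] //.
  move=> w' u' v' hw hu hv Iu Iv; rewrite -!adj_path ?wd //; exact: clx.
have cx x : 1 <= x <= p - 1 -> p.+3 \in I -> x \in I -> w0 \in I.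
  move=> hx cI' xI; apply: (bx x) => //.
  by apply: (clb p.+3 x) => //; rewrite adj_bp // wd.
have cb' : p.+3 \in I -> p.+2 \in I -> w0 \in I.
  move=> cI' bI; apply: (bx t) => //.
  by apply: (clx _ p.+3 p.+2) => //; rewrite adj_pb // wd.
have splI x : x \in I -> [|| 1 <= x <= p - 1, x == p.+2 | x == p.+3].
  by move=> xI; apply: spl; [apply: sI|apply: IX].
case/or3P: (splI u uI) => [hu|/eqP uE|/eqP uE];
  case/or3P: (splI v vI) => [hv|/eqP vE|/eqP vE];
  subst; try (by rewrite eqxx in uv);
  try solve [exact: cb' | apply: bx; eassumption | apply: cx; eassumption].
case/andP: hu hv => u1 u2 /andP[v1 v2].
by case: (ltngtP u v) uv => // h _; [apply: (xx u v)|apply: (xx v u)].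
Qed.

(** The deletion cuts the path into A = {1, ..., k}, where c is adjacent to k only, and C = {k+3,
    ..., p}, which contains the neighbour l of c. Every pair of elements of I leads, possibly
    through several others, to {a, b}, and that pair gives everything. *)
Lemma del_path_middle_indecomposable (k l : nat) :
  2 <= k -> k + 3 <= l <= p -> adj G p.+3 p.+1 -> ~~ adj G p.+3 p.+2 ->
  (forall i, 1 <= i <= k -> adj G p.+3 i = (i == k)) -> adj G p.+3 l ->
  indecomposable (del G [fset k.+1; k.+2]).
Proof.
move=> k2 hl ca ncb ck cl'; have [VG _] := QG.
have ac : adj G p.+1 p.+3 by rewrite adj_sym.
have nbc : ~~ adj G p.+2 p.+3 by rewrite adj_sym.
have lc : adj G l p.+3 by rewrite adj_sym.
have ckk : adj G p.+3 k by rewrite ck ?eqxx //; lia.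
have kc : adj G k p.+3 by rewrite adj_sym.
have c1 : ~~ adj G p.+3 1 by rewrite ck; clear - k2; lia.
pose A x := 1 <= x <= k; pose C x := k + 3 <= x <= p.
have wA x : A x -> 1 <= x <= p by rewrite /A; clear - hl; lia.
have wC x : C x -> 1 <= x <= p by rewrite /C; clear; lia.
have Aa x : A x -> adj G x p.+1.
  by move=> hx; rewrite adj_pa ?wA //; move: hx; rewrite /A; clear - hl; lia.
have aA x : A x -> adj G p.+1 x by move=> hx; rewrite adj_sym Aa.
have AC x y : A x -> C y -> adj G x y = false.
  move=> hx hy; rewrite adj_path; [|exact: wA|exact: wC].
  by move: hx hy; rewrite /A /C; clear; lia.
have CA x y : A x -> C y -> adj G y x = false by move=> hx hy; rewrite adj_sym AC.
have Cl : C l by [].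
have Cp : C p by rewrite /C; clear - hl; lia.
have p0 : 1 <= p <= p by clear - hl; lia.
have nap : ~~ adj G p.+1 p by rewrite adj_ap // ltnn.
have ab := adj_ab; have ba := adj_ba.
have A1 : A 1 by rewrite /A; clear - k2; lia.
have Ak : A k by rewrite /A; clear - k2; lia.
apply: closed_indecomposable_del => I sI cI IX u v uI vI uv w0 w0V w0X.
have spl x : x \in vset G -> x \notin [fset k.+1; k.+2] ->
    [|| A x, C x, x == p.+1, x == p.+2 | x == p.+3].
  by rewrite VG mem_NN !inE /A /C; clear; lia.
have splV x : [|| A x, C x, x == p.+1, x == p.+2 | x == p.+3] ->
    (x \in vset G) && (x \notin [fset k.+1; k.+2]).
  by rewrite VG mem_NN !inE /A /C; clear - hl; lia.
have clA w x y : A w -> x \in I -> y \in I -> adj G w x ->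
    ~~ adj G w y -> w \in I.
  by move=> hw; apply: cI; apply: splV; rewrite hw.
have clC w x y : C w -> x \in I -> y \in I -> adj G w x ->
    ~~ adj G w y -> w \in I.
  by move=> hw; apply: cI; apply: splV; rewrite hw orbT.
have cla x y : x \in I -> y \in I -> adj G p.+1 x -> ~~ adj G p.+1 y -> p.+1 \in I.
  by apply: cI; apply: splV; rewrite eqxx !orbT.
have clb x y : x \in I -> y \in I -> adj G p.+2 x -> ~~ adj G p.+2 y -> p.+2 \in I.
  by apply: cI; apply: splV; rewrite eqxx !orbT.
have clc x y : x \in I -> y \in I -> adj G p.+3 x -> ~~ adj G p.+3 y -> p.+3 \in I.
  by apply: cI; apply: splV; rewrite eqxx !orbT.
have nAb x : A x -> ~~ adj G x p.+2 by move=> hx; rewrite adj_pb // wA.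
have nCb x : C x -> ~~ adj G x p.+2 by move=> hx; rewrite adj_pb // wC.
have nbA x : A x -> ~~ adj G p.+2 x by move=> hx; rewrite adj_bp // wA.
have nbC x : C x -> ~~ adj G p.+2 x by move=> hx; rewrite adj_bp // wC.
have abI : p.+1 \in I -> p.+2 \in I -> w0 \in I.
  move=> aI bI; have cI' : p.+3 \in I by apply: (clc p.+1 p.+2).
  have allA x : A x -> x \in I.
    by move=> hx; apply: (clA _ p.+1 p.+2); rewrite ?Aa ?nAb.
  have allC' x : C x -> x < p -> x \in I.
    by move=> hx xp; apply: (clC _ p.+1 p.+2); rewrite ?nCb ?adj_pa ?wC.
  (* Since p is not adjacent to a, it is reached through c if l = p, and otherwise through p-1,
     which then lies in C. *)
  have pI : p \in I.
    have [lp|lp] := eqVneq l p.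
      rewrite -lp; apply: (clC _ p.+3 p.+2) => //; exact: nCb.
    have Cp1 : C p.-1 by clear - hl lp; rewrite /C; lia.
    have p1 : p == p.-1.+1 by clear - p0; lia.
    have pI1 : p.-1 \in I by apply: allC' => //; clear - p0; lia.
    apply: (clC _ p.-1 p.+2) => //; last exact: nCb.
    by rewrite adj_path ?wC // p1 orbT.
  have allC x : C x -> x \in I.
    move=> hx; have [-> //|xp] := eqVneq x p; apply: allC' => //.
    by move: hx; rewrite /C ltn_neqAle xp => /andP[].
  by case/or4P: (spl w0 w0V w0X) => [/allA|/allC|/eqP->|/orP[/eqP->|/eqP->]].
have aA' x : A x -> p.+1 \in I -> x \in I -> w0 \in I.
  by move=> hx aI xI; apply: abI => //; apply: (clb p.+1 x); rewrite ?nbA.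
have aC' x : C x -> p.+1 \in I -> x \in I -> w0 \in I.
  by move=> hx aI xI; apply: abI => //; apply: (clb p.+1 x); rewrite ?nbC.
have aC'' : p.+1 \in I -> p.+3 \in I -> w0 \in I.
  by move=> aI xI; apply: abI => //; apply: (clb p.+1 p.+3).
have spreadC y x : C x -> (forall z, C z -> ~~ adj G z y) -> y \in I -> x \in I -> p \in I.
  move=> hx hy yI xI.
  apply: (@path_spread (k + 3) p (mem I) x p) => // w hw /=.
  have hw1 : C w by rewrite /C; clear - hw; lia.
  have hw2 : C w.+1 by rewrite /C; clear - hw; lia.
  apply/idP/idP => h; [apply: (clC _ w y)|apply: (clC _ w.+1 y)];
    by rewrite ?hy ?adj_path ?wC // eqxx ?orbT.
have bC x : C x -> p.+2 \in I -> x \in I -> w0 \in I.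
  move=> hx bI xI; have pI := spreadC p.+2 x hx nCb bI xI.
  by apply: abI => //; apply: (cla p.+2 p).
have bc : p.+2 \in I -> p.+3 \in I -> w0 \in I.
  by move=> bI cI'; apply: (bC l) => //; apply: (clC _ p.+3 p.+2) => //; exact: nCb.
have bA x : A x -> p.+2 \in I -> x \in I -> w0 \in I.
  move=> hx bI xI; have allA y : A y -> y \in I.
    move=> hy; apply: (@path_spread 1 k (mem I) x y) => // w hw /=.
    have hw1 : A w by rewrite /A; clear - hw; lia.
    have hw2 : A w.+1 by rewrite /A; clear - hw; lia.
    apply/idP/idP => h; [apply: (clA _ w p.+2)|apply: (clA _ w.+1 p.+2)];
      by rewrite ?nAb ?adj_path ?wA // eqxx ?orbT.
  by apply: bc => //; apply: (clc k 1); rewrite ?allA.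
have AC' x y : A x -> C y -> x \in I -> y \in I -> w0 \in I.
  move=> hx hy xI yI; have pI : p \in I.
    by apply: (spreadC x y) => // z hz; rewrite CA.
  by apply: (aA' x) => //; apply: (cla x p) => //; exact: aA.
have cC x : C x -> p.+3 \in I -> x \in I -> w0 \in I.
  move=> hx cI' xI; apply: (AC' k x) => //.
  by apply: (clA _ p.+3 x) => //; rewrite AC.
have cA x : A x -> p.+3 \in I -> x \in I -> w0 \in I.
  move=> hx cI' xI; apply: (cC l) => //.
  by apply: (clC _ p.+3 x) => //; rewrite CA.
have CC x y : k + 3 <= x -> x < y -> y <= p -> x \in I -> y \in I -> w0 \in I.
  move=> hx xy yp xI yI; have Cx : C x by rewrite /C hx (leq_trans (ltnW xy)).
  have xp : x < p by apply: leq_trans xy yp.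
  (* C may have just three vertices, but in the exceptional case y is p itself. *)
  have pI : p \in I.
    case: (@path_closed (k + 3) p (mem I) x y) => // [|h|[_ <- _]] //.
      move=> w' u' v' hw hu hv Iu Iv; rewrite -!adj_path ?wC //; exact: clC.
    exact: h.
  by apply: (aC' p) => //; apply: (cla x p); rewrite // adj_ap ?wC.
have AA x y : 1 <= x -> x < y -> y <= k -> x \in I -> y \in I -> w0 \in I.
  (* In the exceptional case x = 1 and y = k. These two always suffice, because c is adjacent to k
     and not to 1. *)
  move=> hx xy yk xI yI; have [I1 Ik] : 1 \in I /\ k \in I.
    case: (@path_closed 1 k (mem I) x y) => // [|h|[<- <- _]] //.
      move=> w' u' v' hw hu hv Iu Iv; rewrite -!adj_path ?wA //; exact: clA.
    by split; apply: h.
  by apply: (cA 1) => //; apply: (clc k 1).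
have splI x : x \in I -> [|| A x, C x, x == p.+1, x == p.+2 | x == p.+3].
  by move=> xI; apply: spl; [apply: sI|apply: IX].
case/or4P: (splI u uI) => [hu|hu|/eqP uE|/orP[/eqP uE|/eqP uE]];
  case/or4P: (splI v vI) => [hv|hv|/eqP vE|/orP[/eqP vE|/eqP vE]];
  subst; try (by rewrite eqxx in uv);
  try solve [exact: abI | exact: bc | exact: aC'' | apply: aA'; eassumption | apply: aC'; eassumption | apply: bC; eassumption | apply: bA; eassumption | apply: AC'; eassumption | apply: cC; eassumption | apply: cA; eassumption].
- case/andP: hu hv => u1 u2 /andP[v1 v2].
  by case: (ltngtP u v) uv => // h _; [apply: (AA u v)|apply: (AA v u)].
- case/andP: hu hv => u1 u2 /andP[v1 v2].
  by case: (ltngtP u v) uv => // h _; [apply: (CC u v)|apply: (CC v u)].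
Qed.

Lemma adj_range x : adj G p.+3 x -> 1 <= x <= p.+2.
Proof.
have [VG _] := QG; move=> sx; have /andP[ne _] := sx.
by have := adj_vset sx; rewrite VG !mem_NN; lia.
Qed.

Lemma nbhd_adjP (N : {fset nat}) :
  nbhd G p.+3 = N <-> (forall x, adj G p.+3 x = (x \in N)).
Proof.
have nE x : (x \in nbhd G p.+3) = adj G p.+3 x.
  rewrite !inE andb_idl // => /adj_range; have [-> _] := QG.
  by rewrite mem_NN; lia.
by split=> [<- x|h]; [rewrite nE|apply/fsetP => x; rewrite nE h].
Qed.

(** * Decomposable subgraphs G - {x, y} *)

(** Deleting x cuts 1, ..., x-1 off the rest of the path, so these vertices can form an interval
    together with a suitable z, which will be b or c. The vertex w shows that the interval is
    proper. *)
Lemma prefix_interval_decomposable x y z w :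
  2 <= x -> x < z <= p.+3 -> z != y -> x < w <= p.+3 -> w != y -> w != z ->
  x < y ->
  (forall v, x < v <= p.+3 -> v != y -> v != z ->
     forall i, 1 <= i < x -> adj G v i = adj G v z) ->
  ~~ indecomposable (del G [fset x; y]).
Proof.
have [VG _] := QG; move=> x2 hz zy hw wy wz xy h.
pose I := z |` [fset i in iota 1 x.-1].
have memI i : (i \in I) = (i == z) || (1 <= i < x).
  by rewrite !inE mem_iota; clear - x2; lia.
have memV i : (i \in vset (del G [fset x; y])) = [&& 1 <= i <= p.+3, i != x & i != y].
  by rewrite mem_del VG mem_NN !inE negb_or.
apply: (@proper_interval_decomposable _ _ I 1 z w); rewrite ?memI ?memV ?eqxx //.
- by apply/fsubsetP => i; rewrite memI memV; clear - x2 hz zy xy; lia.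
- by clear - x2; lia.
- by clear - x2 hz; lia.
- by clear - hw wy; lia.
- by clear - hw wz; lia.
move=> v; rewrite memV memI => hv hvI.
have adjE i : i \in I -> adj (del G [fset x; y]) v i = adj G v z.
  rewrite adj_del memI => hi.
  have -> : v \notin [fset x; y] by rewrite !inE; clear - hv; lia.
  have -> /= : i \notin [fset x; y] by rewrite !inE; clear - hi hz zy xy; lia.
  case/orP: hi => [/eqP-> //|hi]; apply: h => //; clear - hv hvI; lia.
case E: (adj G v z); [left|right] => i hi; by rewrite adjE ?E.
Qed.

(** Here z = b: a is adjacent to b and to all of 1, ..., x-1, and the path vertices above x to none
    of these. Only c has to be checked, unless it is deleted. *)
Lemma del_prefix_b_decomposable x y :
  2 <= x <= p -> x < y -> y != p.+2 ->
  (y != p.+3 -> forall i, 1 <= i < x -> adj G p.+3 i = adj G p.+3 p.+2) ->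
  ~~ indecomposable (del G [fset x; y]).
Proof.
move=> hx xy yb hc.
have [w [hw wy wb]] : exists w, [/\ x < w <= p.+3, w != y & w != p.+2].
  by exists (if y == p.+1 then p.+3 else p.+1); case: eqP => ya; split; clear - hx ya; lia.
apply: (@prefix_interval_decomposable x y p.+2 w) => //; try (clear - hx yb; lia).
move=> v hv vy vb i hi.
have [vc|vc] := eqVneq v p.+3; first by rewrite vc hc // -vc eq_sym.
have [->|va] := eqVneq v p.+1.
  by rewrite adj_ab adj_ap; clear - hx hi; lia.
rewrite adj_pb ?adj_path; clear - hx hi hv vb vc va; lia.
Qed.

Lemma del_isolated_decomposable x y z b :
  7 <= p -> 2 <= x -> x < y -> 1 <= z <= p.+3 -> z != x -> z != y ->
  (forall v, 1 <= v <= p.+3 -> v != x -> v != y -> v != z -> adj G z v = b) ->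
  ~~ indecomposable (del G [fset x; y]).
Proof.
have [VG _] := QG; move=> p7 x2 xy hz zx zy h.
have memV i : (i \in vset (del G [fset x; y])) = [&& 1 <= i <= p.+3, i != x & i != y].
  by rewrite mem_del VG mem_NN !inE negb_or.
have [u [v [uV vV uv uz vz]]] : exists u v, [/\ [&& 1 <= u <= p.+3, u != x & u != y],
    [&& 1 <= v <= p.+3, v != x & v != y], u != v, u != z & v != z].
  (* Only three vertices are excluded, so one of 1, ..., 4 and one of 5, ..., 8 are left. *)
  have [m hm] : exists m, [/\ 1 <= m <= 4, m != x, m != y & m != z].
    have [h1|h1] := boolP [&& 1 != x, 1 != y & 1 != z]; first by exists 1; split; lia.
    have [h2|h2] := boolP [&& 2 != x, 2 != y & 2 != z]; first by exists 2; split; lia.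
    have [h3|h3] := boolP [&& 3 != x, 3 != y & 3 != z]; first by exists 3; split; lia.
    by exists 4; split; lia.
  have [m' hm'] : exists m, [/\ 5 <= m <= 8, m != x, m != y & m != z].
    have [h1|h1] := boolP [&& 5 != x, 5 != y & 5 != z]; first by exists 5; split; lia.
    have [h2|h2] := boolP [&& 6 != x, 6 != y & 6 != z]; first by exists 6; split; lia.
    have [h3|h3] := boolP [&& 7 != x, 7 != y & 7 != z]; first by exists 7; split; lia.
    by exists 8; split; lia.
  by exists m, m'; case: hm hm' => ? ? ? ? [? ? ? ?]; split; lia.
apply: (@singleton_complement_decomposable _ _ z u v b); rewrite ?memV ?hz ?zx //.
move=> w; rewrite memV => /and3P[hw wx wy] wz.
rewrite adj_del -(h w) // !inE.
by rewrite (negbTE zx) (negbTE zy) (negbTE wx) (negbTE wy).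
Qed.

(** With a deleted, b becomes isolated. *)
Lemma del_above_a_decomposable x :
  7 <= p -> 2 <= x <= p -> ~~ adj G p.+3 p.+2 ->
  ~~ indecomposable (del G [fset x; p.+1]).
Proof.
move=> p7 hx cb; apply: (@del_isolated_decomposable _ _ p.+2 false) => //;
  try (clear - hx; lia).
move=> v hv vx va vb; have [->|vc] := eqVneq v p.+3.
  by rewrite adj_sym (negbTE cb).
by rewrite adj_bp //; clear - hv va vb vc; lia.
Qed.

Lemma del_ac_decomposable : 7 <= p -> ~~ indecomposable (del G [fset p.+1; p.+3]).
Proof.
move=> p7; apply: (@del_isolated_decomposable _ _ p.+2 false) => //;
  try (clear - p7; lia).
by move=> v hv va vc vb; rewrite adj_bp //; clear - hv va vb vc; lia.
Qed.

(** Here z = c: a is adjacent to c and to 1, ..., x-1, while b and the remaining path vertices above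
    x are adjacent to none of them. *)
Lemma del_prefix_c_decomposable x y :
  2 <= x -> x < y <= p -> adj G p.+3 p.+1 -> ~~ adj G p.+3 p.+2 ->
  (forall i, x < i <= p -> i != y -> ~~ adj G p.+3 i) ->
  ~~ indecomposable (del G [fset x; y]).
Proof.
move=> x2 hy ca cb hc.
apply: (@prefix_interval_decomposable x y p.+3 p.+1) => //; try (clear - hy; lia).
move=> v hv vy vc i hi; rewrite [RHS]adj_sym.
have [->|va] := eqVneq v p.+1; first by rewrite ca adj_ap; clear - hy hi; lia.
have [->|vb] := eqVneq v p.+2.
  by rewrite (negbTE cb) adj_bp //; clear - hy hi; lia.
rewrite adj_path ?(negbTE (hc v _ _)) //; clear - hy hi hv va vb vc; lia.
Qed.

(** * The listed neighbourhoods give members of the class *)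

Definition extremal_nbhd (q : nat) (s : pred nat) : Prop :=
  [\/ s =1 [pred x | (1 <= x <= q) || (x == q.+2)],
      s =1 pred1 q,
      exists2 k, (1 <= k <= q) && (k != 2) & s =1 [pred x | (x == q.+1) || (x == k)]
    | exists2 k, 2 <= k < q & s =1 [pred x | [|| x == q.+1, x == k | x == k.+1]]].

Lemma extremal_indecomposable :
  7 <= p -> extremal_nbhd p (adj G p.+3) -> indecomposable G.
Proof.
move=> p7 ext; apply: Qextension_indecomposable => //; first by clear - p7; lia.
  case: ext => [sE|sE|[k hk sE]|[k hk sE]].
  - by exists 1, p.+1; rewrite !sE /=; split; clear - p7; lia.
  - by exists p, 1; rewrite !sE /=; split; clear - p7; lia.
  - by exists p.+1, p.+2; rewrite !sE /=; split; clear - p7 hk; lia.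
  - by exists p.+1, p.+2; rewrite !sE /=; split; clear - p7 hk; lia.
move=> v hv.
suff [w [hw wv dw]] : exists w, [/\ 1 <= w <= p.+2, w != v & Qadj p w v != adj G p.+3 w].
  by exists w; rewrite (proj2 QG) // [adj G w p.+3]adj_sym.
case: ext => [sE|sE|[k hk sE]|[k hk sE]].
- exists (if v <= 3 then 5 else if v == p.+1 then p else 1).
  by rewrite sE /Qadj /=; do 2?case: ifP; split; lia.
- exists (if v == p then p.-1 else if v == p.+1 then 1 else p.+1).
  by rewrite sE /Qadj /=; do 2?case: ifP; split; lia.
(* For v < p both v and c are adjacent to a, so a path neighbour of v other than k is taken. For v =
   1 this can only be 2, hence the condition that k is not 2. *)
- exists (if v == p.+1 then p.+2 else if v == p.+2 then k else
          if v == p then p.+1 else if (v == 1) || (v == k.+1) then v.+1 else v.-1).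
  rewrite sE /Qadj /=; clear - hk hv p7.
  by do 4?[case: ifP => ?]; split; lia.
(* As before, with a path neighbour of v outside {k, k+1}; if v = 1 and k = 2 there is none, and 3
   is adjacent to c but not to 1. *)
- exists (if v == p.+1 then p.+2 else if v == p.+2 then k else if v == p then p.+1 else
          if v == 1 then (if k == 2 then 3 else 2) else
          if (v == k.+1) || (v == k.+2) then v.+1 else v.-1).
  rewrite sE /Qadj /=; clear - hk hv p7.
  by do 5?[case: ifP => ?]; split; lia.
Qed.

Lemma extremal_del_decomposable x y :
  7 <= p -> extremal_nbhd p (adj G p.+3) -> 2 <= x -> x < y <= p.+3 ->
  x != p.+2 -> y != p.+2 -> ~~ indecomposable (del G [fset x; y]).
Proof.
move=> p7 ext x2 hy xb yb; have [xp|px] := leqP x p; last first.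
  have -> : x = p.+1 by clear - px hy xb yb; lia.
  have -> : y = p.+3 by clear - px hy xb yb; lia.
  exact: del_ac_decomposable.
have hx : 2 <= x <= p by rewrite x2.
have [yc|yc] := eqVneq y p.+3.
  by apply: del_prefix_b_decomposable => //; rewrite ?yc ?eqxx //; clear - xp; lia.
case: ext => [sE|sE|[k hk sE]|[k hk sE]].
- have [->|ya] := eqVneq y p.+1.
    apply: (del_isolated_decomposable (z := p.+3) (b := true)) => //; try (clear - hx; lia).
    by move=> v hv vx va vc; rewrite sE /=; clear - hv vx va vc; lia.
  apply: del_prefix_b_decomposable => //; first by case/andP: hy.
  by move=> _ i hi; rewrite !sE /=; clear - hi hx; lia.
- apply: del_prefix_b_decomposable => //; first by case/andP: hy.
  by move=> _ i hi; rewrite !sE /=; clear - hi hx; lia.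
- have cb : ~~ adj G p.+3 p.+2 by rewrite sE /=; clear - hk; lia.
  have [->|ya] := eqVneq y p.+1; first exact: del_above_a_decomposable.
  (* If x is at most k, c has no neighbour below x and b completes the interval; otherwise c has no
     neighbour on the path above x and completes it itself. *)
  have [xk|kx] := leqP x k.
    apply: del_prefix_b_decomposable => //; first by case/andP: hy.
    by move=> _ i hi; rewrite !sE /=; clear - hi hx xk hk; lia.
  apply: del_prefix_c_decomposable => //; first by clear - hy ya yb yc; lia.
    by rewrite sE /= eqxx.
  by move=> i hi _; rewrite sE /=; clear - hi kx; lia.
- have cb : ~~ adj G p.+3 p.+2 by rewrite sE /=; clear - hk; lia.
  have [->|ya] := eqVneq y p.+1; first exact: del_above_a_decomposable.
  have [xk|kx] := leqP x k.
    apply: del_prefix_b_decomposable => //; first by case/andP: hy.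
    by move=> _ i hi; rewrite !sE /=; clear - hi hx xk hk; lia.
  apply: del_prefix_c_decomposable => //; first by clear - hy ya yb yc; lia.
    by rewrite sE /= eqxx.
  by move=> i hi _; rewrite sE /=; clear - hi kx; lia.
Qed.

Lemma indecomposable_not_twin u :
  7 <= p -> indecomposable G -> 1 <= u <= p.+2 ->
  ~ (forall x, 1 <= x <= p.+2 -> x != u -> adj G p.+3 x = Qadj p u x).
Proof.
move=> p7 iG hu h; have [VG QE] := QG.
move: iG; apply/negP.
have [w [hw wu]] : exists w, [/\ 1 <= w <= p.+2 & w != u].
  by exists (if u == 1 then 2 else 1); case: eqP => u1; split; clear - p7 u1; lia.
apply: (@twins_decomposable _ G u p.+3 w);
  rewrite ?VG ?mem_NN //; try (clear - hu hw; lia).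
move=> x; rewrite mem_NN => hx xu xc; rewrite !(adj_sym _ x) h //.
  by rewrite QE //; clear - hx xc; lia.
by clear - hx xc; lia.
Qed.

Lemma indecomposable_not_const b :
  7 <= p -> indecomposable G ->
  ~ (forall x, 1 <= x <= p.+2 -> adj G p.+3 x = b).
Proof.
move=> p7 iG h; have [VG _] := QG.
move: iG; apply/negP.
apply: (@singleton_complement_decomposable _ G p.+3 1 2 b);
  rewrite ?VG ?mem_NN ?leqnn //.
by move=> x; rewrite mem_NN => hx xc; apply: h; clear - hx xc; lia.
Qed.

Lemma extremal_of_decomposable_dels :
  8 <= p -> indecomposable G ->
  (forall x y, 2 <= x -> x < y <= p.+3 -> x != p.+2 -> y != p.+2 ->
     ~~ indecomposable (del G [fset x; y])) ->
  extremal_nbhd p (adj G p.+3).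
Proof.
move=> p8 iG dec; have p7 : 7 <= p by apply: ltnW.
pose s := adj G p.+3.
have s_out x : ~~ (1 <= x <= p.+2) -> s x = false.
  by move=> hx; apply: contraNF hx => /adj_range.
have ntwin u (hu : 1 <= u <= p.+2) := indecomposable_not_twin p7 iG hu.
have nconst b := indecomposable_not_const (b := b) p7 iG.
have dec23 : s 1 != s p.+2 -> (s p.+1 -> exists2 t, 4 <= t <= p & s t) -> False.
  move=> h1 h2; have /negP[] : ~~ indecomposable (del G [fset 2; 3]).
    by apply: dec; clear - p8; lia.
  exact: del_2_3_indecomposable.
have decab : s p.+2 -> (exists u v, [/\ 1 <= u <= p - 1, 1 <= v <= p - 1, s u & ~~ s v]) ->
    False.
  move=> h1 h2; have /negP[] : ~~ indecomposable (del G [fset p; p.+1]).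
    by apply: dec; clear - p8; lia.
  by apply: del_path_end_a_indecomposable => //; clear - p8; lia.
have range x : 1 <= x <= p.+2 ->
    [\/ 1 <= x <= p - 2, x = p.-1, x = p | x = p.+1 \/ x = p.+2].
  move=> hx; have [h|h] := boolP (1 <= x <= p - 2); first by constructor 1.
  have [->|h1] := eqVneq x p.-1; first by constructor 2.
  have [->|h2] := eqVneq x p; first by constructor 3.
  by constructor 4; clear - hx h h1 h2; lia.
case sa: (s p.+1); case sb: (s p.+2).
(* Both a and b are neighbours of c, which must be constant on 1, ..., p-1. If it is adjacent to all
   of these, c is complete or a twin of a; if to none, {2, 3} applies with t = p, or c is a twin of
   b. *)
- exfalso; case: (const_or_not (p - 1) s) => [h|h|]; last by apply: decab.
    have [sp|/negbTE sp] := boolP (s p).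
      apply: (nconst true) => x hx; rewrite -/s.
      case: (range x hx) => [h1|->|->|[->|->]] //; apply: h;
        try (clear - p8 h1; lia); clear - p8; lia.
    apply: (ntwin p.+1); first by clear; lia.
    move=> x hx; rewrite -/s /Qadj.
    case: (range x hx) => [h1|->|->|[->|->]]; rewrite ?sp ?sa ?sb ?h //; try (clear - p8 h1; lia); clear - p8; lia.
  have [sp|/negbTE sp] := boolP (s p).
    by apply: dec23; rewrite ?sb ?(negbTE (h 1 _)) //; [clear - p8; lia|exists p => //; clear - p8; lia].
  apply: (ntwin p.+2); first by clear; lia.
  move=> x hx; rewrite -/s /Qadj.
  case: (range x hx) => [h1|->|->|[->|->]]; rewrite ?sp ?sa ?sb ?(negbTE (h _ _)) //;
    try (clear - p8 h1; lia); clear - p8; lia.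
(* Now a is a neighbour of c and b is not. With no neighbour on the path c is a twin of b; otherwise
   the distance between its first and last path neighbours k and l decides. *)
- have [ex|nex] := boolP (has s (iota 1 p)); last first.
    have h x : 1 <= x <= p -> s x = false.
      move=> hx; apply: negbTE; apply: (hasPn nex); rewrite mem_iota; clear - hx; lia.
    exfalso; apply: (ntwin p.+2); first by clear; lia.
    move=> x hx; rewrite -/s /Qadj.
    case: (range x hx) => [h1|->|->|[->|->]]; rewrite ?sa ?sb ?h //; try (clear - p8 h1; lia); clear - p8; lia.
  have [|k [l [hk lp sk sl kl]]] := @first_last p s.
    by case/hasP: ex => i; rewrite mem_iota => hi si; exists i => //; clear - hi; lia.
  have sE x : s x = [|| x == p.+1, x == k, x == l | [&& k < x, x < l & s x]].
    have [hx|hx] := boolP (1 <= x <= p); last first.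
      have [->|xa] := eqVneq x p.+1; first by rewrite sa.
      have [->|xb] := eqVneq x p.+2; first by rewrite sb; clear - hk lp; lia.
      by rewrite s_out; clear - hk lp hx xa xb; lia.
    have [->|xk] := eqVneq x k; first by rewrite sk orbT.
    have [->|xl] := eqVneq x l; first by rewrite sl !orbT.
    case sx: (s x); last by clear - hx xk xl; lia.
    by have := kl x hx sx; clear - hx xk xl; lia.
  have [l3|l3] := leqP (k + 3) l.
    exfalso; have [k1|k1] := eqVneq k 1.
      apply: dec23; first by rewrite sb -k1 sk.
      by move=> _; exists l => //; clear - l3 k1 lp hk; lia.
    have /negP[] : ~~ indecomposable (del G [fset k.+1; k.+2]).
      by apply: dec; clear - l3 lp hk; lia.
    apply: (@del_path_middle_indecomposable k l); rewrite ?sb //.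
    - by clear - hk k1; lia.
    - by rewrite l3.
    - exact: negbT.
    - move=> i hi; have [->|ik] := eqVneq i k; first exact: sk.
      by rewrite -/s sE; clear - hi ik l3 lp; lia.
  have [lk|lk] := eqVneq l k.
    have sE' x : s x = (x == p.+1) || (x == k) by rewrite sE lk; clear; lia.
    have [k2|k2] := eqVneq k 2; last first.
      by constructor 3; exists k => //; rewrite k2; clear - hk lp; lia.
    exfalso; apply: (ntwin 1) => // x hx x1; rewrite -/s sE' k2 /Qadj.
    by clear - p8 hx x1; lia.
  have [lk1|lk1] := eqVneq l k.+1.
    have sE' x : s x = [|| x == p.+1, x == k | x == k.+1] by rewrite sE lk1; clear; lia.
    have [k1|k1] := eqVneq k 1; last first.
      by constructor 4; exists k => //; clear - k1 hk lp lk1; lia.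
    exfalso; apply: (ntwin 1) => // x hx x1; rewrite -/s sE' k1 /Qadj.
    by clear - p8 hx x1; lia.
  (* Here l = k+2, so c and k+1 are twins, whether adjacent or not. *)
  exfalso; apply: (ntwin k.+1); first by clear - hk lp; lia.
  move=> x hx xk; rewrite -/s sE /Qadj; clear - hk l3 lk lk1 lp hx xk p8; lia.
(* Now b is a neighbour of c and a is not. The pair {2, 3} forces 1 into N(c), the pair {p, a} then
   forces 1, ..., p-1, and without p the vertex c would be a twin of a. *)
- have [s1|/negbTE s1] := boolP (s 1); last first.
    by exfalso; apply: dec23; rewrite ?s1 ?sa ?sb.
  case: (const_or_not (p - 1) s) => [h|h|].
  + have sE' x : x != p -> s x = (1 <= x <= p) || (x == p.+2).
      move=> xp; have [hx|hx] := boolP (1 <= x <= p.+2); last first.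
        by rewrite s_out //; clear - hx; lia.
      case: (range x hx) xp => [h1|->|->|[->|->]] xp; rewrite ?eqxx // in xp *;
        rewrite ?sa ?sb ?h //; try (clear - p8 h1; lia); clear - p8; lia.
    have [sp|/negbTE sp] := boolP (s p).
      constructor 1 => x /=; have [->|xp] := eqVneq x p; last exact: sE'.
      by rewrite -/s sp; clear - p8; lia.
    exfalso; apply: (ntwin p.+1); first by clear; lia.
    move=> x hx xa; rewrite -/s /Qadj; have [->|xp] := eqVneq x p.
      by rewrite sp; clear - p8; lia.
    by rewrite sE' //; clear - p8 hx xa xp; lia.
  + by have := h 1; rewrite s1 => /(_ _) h'; exfalso; move: h'; clear - p8; lia.
  + by move=> h; exfalso; apply: decab.
(* Neither a nor b is a neighbour of c. The pairs {2, 3} and {p-1, p} exclude 1, ..., p-2 from N(c).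
   If p-1 is in N(c), c is a twin of p; otherwise N(c) is {p} or empty. *)
- have [s1|/negbTE s1] := boolP (s 1).
    by exfalso; apply: dec23; rewrite ?s1 ?sa ?sb.
  case: (const_or_not (p - 2) s) => [h|h|h].
  + by have := h 1; rewrite s1 => h'; exfalso; move: h'; clear - p8; lia.
  + have sE' x : x != p -> x != p.-1 -> s x = false.
      move=> xp xp1; have [hx|hx] := boolP (1 <= x <= p.+2); last exact: s_out.
      case: (range x hx) => [h1|xE|xE|[->|->]] //; first exact: negbTE (h _ h1).
        by rewrite xE eqxx in xp1.
      by rewrite xE eqxx in xp.
    have [sp1|/negbTE sp1] := boolP (s p.-1).
      exfalso; apply: (ntwin p); first by clear - p8; lia.
      move=> x hx xp; rewrite -/s /Qadj; have [->|xp1] := eqVneq x p.-1.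
        by rewrite sp1; clear - p8; lia.
      by rewrite sE' //; clear - p8 hx xp xp1; lia.
    have [sp|/negbTE sp] := boolP (s p).
      constructor 2 => x /=; have [->|xp] := eqVneq x p; first exact: sp.
      by have [->|xp1] := eqVneq x p.-1; [exact: sp1|exact: sE'].
    exfalso; apply: (nconst false) => x _.
    have [->|xp] := eqVneq x p; first exact: sp.
    by have [->|xp1] := eqVneq x p.-1; [exact: sp1|exact: sE'].
  + exfalso; have /negP[] : ~~ indecomposable (del G [fset p - 1; p]).
      by apply: dec; clear - p8; lia.
    apply: del_path_end_indecomposable => //; try exact: negbT.
    by clear - p8; lia.
Qed.

End Adjacency.

(** * Translation to the statement, and conclusion *)

Lemma extremal_nbhdE (p : nat) (G : sgraph nat) : 2 <= p -> Qextension p G ->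
  extremal_nbhd p (adj G p.+3) <->
  [\/ nbhd G p.+3 = NN p `|` [fset p.+2],
      nbhd G p.+3 = [fset p],
      (exists2 k : nat, k \in NN p `\` [fset 2] & nbhd G p.+3 = [fset p.+1; k])
    | (exists2 k : nat, 2 <= k <= p.-1 & nbhd G p.+3 = [fset p.+1; k; k.+1])].
Proof.
move=> p2 QG; have nE N := nbhd_adjP QG N.
split=> -[h|h|[k hk h]|[k hk h]].
- by constructor 1; apply/nE => x; rewrite h /= in_fsetU mem_NN in_fset1.
- by constructor 2; apply/nE => x; rewrite h /= in_fset1.
- constructor 3; exists k; first by rewrite in_fsetD in_fset1 mem_NN andbC.
  by apply/nE => x; rewrite h /= !inE.
- constructor 4; exists k; first by clear - hk p2; lia.
  by apply/nE => x; rewrite h /= !inE orbA.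
- by constructor 1 => x; move/nE: h => ->; rewrite /= in_fsetU mem_NN in_fset1.
- by constructor 2 => x; move/nE: h => ->; rewrite /= in_fset1.
- constructor 3; exists k; first by move: hk; rewrite in_fsetD in_fset1 mem_NN andbC.
  by move=> x; move/nE: h => ->; rewrite /= !inE.
- constructor 4; exists k; first by clear - hk p2; lia.
  by move=> x; move/nE: h => ->; rewrite /= !inE orbA.
Qed.

(** Identifies the number of vertices quantified inside [Qm1] with the given n. *)
Lemma NN_inj : injective NN.
Proof.
move=> m n mn; have h i : (1 <= i <= m) = (1 <= i <= n) by rewrite -!mem_NN mn.
by have := h m; have := h n; lia.
Qed.

Lemma covered_indec_graphP (K : choiceType) (G : sgraph K) (X : {fset K}) :
  covered (indec_graph G) X <->
  X `<=` vset G /\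
  forall x y, x \in vset G -> y \in vset G -> x != y -> x \notin X -> y \notin X ->
    ~~ indecomposable (del G [fset x; y]).
Proof.
split=> -[sX h]; split=> //.
  move=> x y xV yV xy xX yX; apply/negP => iG.
  have : adj (indec_graph G) x y by rewrite adj_indec_graph xy xV yV.
  case/andP=> _ /h[z]; rewrite in_fset2 => /orP[]/eqP->.
    by rewrite (negbTE xX).
  by rewrite (negbTE yX).
move=> e he; have /andP[_ e2] := allP (eset_in _) e he.
have [x xe] : exists x, x \in e.
  by have [e0|[x xe]] := fset_0Vmem e; [rewrite e0 cardfs0 in e2|exists x].
rewrite (cardfsD1 x) xe in e2; have /cardfs1P[y ey] := e2.
have eE : e = [fset x; y] by rewrite -(fsetD1K xe) ey.
have xy : x != y.
  by have : y \in e `\ x by [rewrite ey in_fset1]; rewrite in_fsetD1 eq_sym => /andP[].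
have : adj (indec_graph G) x y by rewrite /adj xy -eE.
rewrite adj_indec_graph => /and4P[_ xV yV iG].
have [xX|xX] := boolP (x \in X); first by exists x; rewrite // eE in_fset2 eqxx.
exists y; first by rewrite eE in_fset2 eqxx orbT.
by apply: contraLR iG => yX; apply: h.
Qed.

Local Open Scope fset_scope.

Theorem proposition4p2 (n : nat) (hn : 11 <= n) (G : sgraph nat)
    (hG : vset G = NN n) :
  Qm1 G <->
  (del G [fset n] = Qgraph (n - 1) /\
   [\/ nbhd G n = NN (n - 3) `|` [fset n - 1],
       nbhd G n = [fset n - 3],
       (exists2 k : nat, k \in NN (n - 3) `\` [fset 2] &
          nbhd G n = [fset n - 2; k])
     | (exists2 k : nat, 2 <= k <= n - 4 &
          nbhd G n = [fset n - 2; k; k.+1])]).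
Proof.
(* Writing n as p+3 removes the truncated subtractions. *)
have [p nE] : exists p, n = p.+3 by exists (n - 3)%N; lia.
have p8 : (8 <= p)%N by lia.
have [e1 e2 e3 e4] : [/\ n - 1 = p.+2, n - 2 = p.+1, n - 3 = p & n - 4 = p.-1]%N.
  by split; lia.
rewrite e1 e2 e3 e4 nE; rewrite nE in hG; clear hn nE e1 e2 e3 e4 n.
have p1 : (1 < p)%N by lia.
have p7 : (7 <= p)%N by lia.
split=> [[n [_ VG iG cov dG]]|[dG]].
  have nE : n = p.+3 by apply: NN_inj; rewrite -VG hG.
  move: cov dG; rewrite {}nE subn1 /= => /covered_indec_graphP[_ cov] dG; split=> //.
  have QG := del_Qgraph_Qextension p1 hG dG.
  apply/(extremal_nbhdE p1 QG); apply: extremal_of_decomposable_dels => //.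
  move=> x y hx hy xb yb; apply: cov; rewrite ?hG ?mem_NN ?in_fset2; lia.
have QG := del_Qgraph_Qextension p1 hG dG.
move/(extremal_nbhdE p1 QG) => ext; exists p.+3.
have p11 : (11 <= p.+3)%N by lia.
rewrite subn1 /=; split=> //; first exact: extremal_indecomposable QG p7 ext.
apply/covered_indec_graphP; split.
  by rewrite fsubUset !fsub1set hG !mem_NN; lia.
have lt x y : x \in vset G -> y \in vset G -> (x < y)%N -> x \notin [fset 1%N; p.+2] ->
    y \notin [fset 1%N; p.+2] -> ~~ indecomposable (del G [fset x; y]).
  rewrite hG !mem_NN !in_fset2 => hx hy xy nx ny.
  by apply: (extremal_del_decomposable QG p7 ext); lia.
move=> x y xV yV xy xX yX; case: (ltngtP x y) xy => // h _; first exact: lt.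
by rewrite fsetUC; apply: lt.
Qed.
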